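(* Let $\Gamma$ be a digraph with vertex set $\{1,\dots,n\}$, $n>1$, and let $S=(s_{ij})_{n\times n}$ have positive off-diagonal entries and determine a transitional measure for $\Gamma$. Define $d(i,j)=\tfrac12\bigl(\ln s_{ii}+\ln s_{jj}-\ln s_{ij}-\ln s_{ji}\bigr)$ for $i,j\in\{1,\dots,n\}$ (the logarithmic distance corresponding to $S$). Then $d$ is graph-geodetic for $\Gamma$: for all vertices $i,j,k$, $d(i,j)+d(j,k)=d(i,k)$ holds if and only if every directed path in $\Gamma$ connecting $i$ and $k$ in either direction (i.e. every path from $i$ to $k$ and every path from $k$ to $i$) contains $j$.
   Context: A digraph $\Gamma$ here is a weighted directed multigraph without loops, with vertex set $\{1,\dots,n\}$, $n>1$; each arc has a positive weight. A directed path from $v_0$ to $v_k$ is an alternating sequence $v_0,a_1,v_1,\dots,a_k,v_k$ of vertices and arcs in which all vertices are distinct and each $a_i$ is an arc from $v_{i-1}$ to $v_i$; for each vertex $v_0$ the sequence $v_0$ (length $0$) is the unique path from $v_0$ to $v_0$. $S$ satisfies the transition inequality if $s_{ij}s_{jk}\le s_{ik}s_{jj}$ for all $i,j,k$; it satisfies the graph bottleneck identity w.r.t. $\Gamma$ if for all $i,j,k$: $s_{ij}s_{jk}=s_{ik}s_{jj}$ holds if and only if every directed path in $\Gamma$ from $i$ to $k$ contains $j$. $S$ determines a transitional measure for $\Gamma$ if it satisfies both.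
   Formalization: For n = 2 the diagonal entries of S are additionally assumed positive: s_11 = s_22 = -2, s_12 = s_21 = 1 meets all stated hypotheses, yet ln s_11, and so d, is undefined. For n ≥ 3 positivity of the diagonal follows from the hypotheses and is not assumed. *)

(* Defs.v *)
From HB Require Import structures.
From mathcomp Require Import all_boot all_order all_algebra.
From mathcomp Require Import reals exp.
Set Implicit Arguments.
Unset Strict Implicit.
Unset Printing Implicit Defensive.
Import Order.TTheory GRing.Theory Num.Theory.
Local Open Scope ring_scope.

(* The vertex set {1, ..., n} is encoded as 'I_n; parallel arcs are distinct
   elements of [arc] with the same ends. *)
Record digraph (R : realType) (n : nat) := Digraph {
  arc : finType;
  src : arc -> 'I_n;
  tgt : arc -> 'I_n;
  weight : arc -> R;
  weight_gt0 : forall a, 0 < weight a;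
  no_loop : forall a, src a != tgt a
}.

Section Paths.
Variables (R : realType) (n : nat) (G : digraph R n).

(* The alternating sequence v0, a1, v1, ..., ak, vk is encoded as its first
   vertex v0 together with the list [:: (a1, v1); ...; (ak, vk)]. *)
Definition altseq := seq (arc G * 'I_n).

Definition vertices (v0 : 'I_n) (p : altseq) : seq 'I_n := v0 :: map snd p.

Fixpoint is_walk (v0 : 'I_n) (p : altseq) : bool :=
  if p is (a, v) :: p' then [&& src a == v0, tgt a == v & is_walk v p']
  else true.

Definition is_dipath (i k : 'I_n) (p : altseq) : bool :=
  [&& is_walk i p, uniq (vertices i p) & last i (map snd p) == k].

Definition all_dipaths_contain (i k j : 'I_n) : Prop :=
  forall p : altseq, is_dipath i k p -> j \in vertices i p.

Definition bottleneck_identity (S : 'M[R]_n) : Prop :=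
  forall i j k : 'I_n,
    S i j * S j k = S i k * S j j <-> all_dipaths_contain i k j.

Definition graph_geodetic (d : 'I_n -> 'I_n -> R) : Prop :=
  forall i j k : 'I_n,
    d i j + d j k = d i k <->
    all_dipaths_contain i k j /\ all_dipaths_contain k i j.

End Paths.

Definition transition_inequality (R : realType) (n : nat) (S : 'M[R]_n) : Prop :=
  forall i j k : 'I_n, S i j * S j k <= S i k * S j j.

Definition transitional_measure (R : realType) (n : nat) (G : digraph R n)
    (S : 'M[R]_n) : Prop :=
  transition_inequality S /\ bottleneck_identity G S.

(* [ln] is total, with value 0 on nonpositive arguments, so this is the
   logarithmic distance only when the entries of [S] involved are positive. *)
Definition log_distance (R : realType) (n : nat) (S : 'M[R]_n) (i j : 'I_n) : R :=
  2^-1 * (ln (S i i) + ln (S j j) - ln (S i j) - ln (S j i)).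

(* Positivity of the diagonal entries, needed for their logarithms to be
   defined.  For n > 2 it follows from the transition inequality applied to
   three distinct vertices and the positivity of the off-diagonal entries, so
   only n = 2 is mentioned.  There it does not follow: the matrix with diagonal
   entries -2 and off-diagonal entries 1 determines a transitional measure for
   every digraph on two vertices. *)
Definition diagonal_logs_defined (R : realType) (n : nat) (S : 'M[R]_n) : Prop :=
  n = 2%N -> forall i : 'I_n, 0 < S i i.

(* Main.v *)
(* Twice the defect d(i,j) + d(j,k) - d(i,k) splits as
     ln (s_ik s_jj / (s_ij s_jk)) + ln (s_ki s_jj / (s_kj s_ji)).
   Both summands are nonnegative by the transition inequality, so the defect
   vanishes iff both do, i.e. iff the bottleneck equality holds at (i, j, k)
   and at (k, j, i). *)
Require Import Defs.
From mathcomp Require Import all_boot all_order all_algebra.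
From mathcomp Require Import reals exp.
From mathcomp Require Import lra.
Import Order.TTheory GRing.Theory Num.Theory.
Local Open Scope ring_scope.

(** For n > 2, two distinct vertices a, b other than i give 0 < s_ai s_ib <= s_ab s_ii, and s_ab > 0
    can be cancelled. *)
Lemma transition_entry_gt0 (R : realType) (n : nat) (S : 'M[R]_n) :
  (1 < n)%N -> (forall i j : 'I_n, i != j -> 0 < S i j) ->
  diagonal_logs_defined S -> transition_inequality S ->
  forall i j : 'I_n, 0 < S i j.
Proof.
move=> n_gt1 offdiag_gt0 diag_gt0 transS i j.
have [<-|/offdiag_gt0//] := eqVneq i j.
have [/diag_gt0 //|n_neq2] := eqVneq n 2%N.
have: (1 < #|predC1 i|)%N.
  by rewrite cardC1 card_ord -ltnS prednK ?(ltnW n_gt1) // ltn_neqAle eq_sym n_neq2.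
move=> /card_gt1P[a [b [ai bi ab]]]; rewrite !inE in ai bi.
have := transS a i b.
rewrite -(pmulr_rgt0 (S i i) (offdiag_gt0 _ _ ab)); apply: lt_le_trans.
by rewrite mulr_gt0 ?offdiag_gt0 // eq_sym.
Qed.

Theorem theorem2 (R : realType) (n : nat) (hn : (1 < n)%N)
    (G : digraph R n) (S : 'M[R]_n)
    (hpos : forall i j : 'I_n, i != j -> 0 < S i j)
    (hdiag : diagonal_logs_defined S)
    (hS : transitional_measure G S) :
  graph_geodetic G (log_distance S).
Proof.
case: hS => transS bottleneckS i j k.
have S_gt0 := transition_entry_gt0 _ _ _ hn hpos hdiag transS.
have lnSM a b c d : ln (S a b * S c d) = ln (S a b) + ln (S c d).
  by rewrite lnM // posrE.
have ln_trans a b c : ln (S a b) + ln (S b c) <= ln (S a c) + ln (S b b).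
  by rewrite -!lnSM ler_ln ?posrE ?mulr_gt0.
have ln_bottleneck a b c :
    ln (S a b) + ln (S b c) = ln (S a c) + ln (S b b) <->
    all_dipaths_contain G a c b.
  rewrite -bottleneckS -!lnSM; split=> [|-> //].
  (* Going back from logarithms to products requires positivity, since [ln] is injective only
     there. *)
  by apply: ln_inj; rewrite posrE mulr_gt0.
rewrite -!ln_bottleneck /log_distance.
(* With the logarithms as atoms the goal is linear; these two inequalities force both equalities
   from their sum. *)
have := ln_trans i j k; have := ln_trans k j i.
by split=> [?|[? ?]]; [split|]; lra.
Qed.
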